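(* Let $G$ be a finite group. The property of being a homomorphism for functions $f:G\to\mathbb{D}$ (that is, $f(x)f(y)=f(xy)$ for all $x,y\in G$) has a one-sided error tester with query complexity $O(\epsilon^{-2}\log(1/\epsilon))$, where the constant in the $O(\cdot)$ does not depend on $G$.
   Context: $\mathbb{D}=\{z\in\mathbb{C}: |z|\le 1\}$. For $f,g:G\to\mathbb{D}$, $\mathrm{dist}(f,g)=\frac12\|f-g\|_2$ with $\|h\|_2=\sqrt{\mathbf{E}_{x\in G}|h(x)|^2}$ ($x$ uniform in $G$). A function $f$ is $\epsilon$-far from a property $\mathcal{P}$ if $\mathrm{dist}(f,g)\ge\epsilon$ for every $g:G\to\mathbb{D}$ satisfying $\mathcal{P}$. A tester for $\mathcal{P}$ is a randomized algorithm that, given $\epsilon>0$ and query access to $f:G\to\mathbb{D}$ (it may sample uniform elements of $G$ and perform group operations), accepts with probability at least $2/3$ if $f$ satisfies $\mathcal{P}$ and rejects with probability at least $2/3$ if $f$ is $\epsilon$-far from $\mathcal{P}$. It is one-sided error if it accepts with probability $1$ whenever $f$ satisfies $\mathcal{P}$. The query complexity is the number of queries to $f$. *)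

(* Defs.v *)
From mathcomp Require Import all_boot all_order all_algebra all_fingroup.
From mathcomp Require Import all_classical all_reals all_analysis.
From mathcomp Require Import complex.

Set Implicit Arguments.
Unset Strict Implicit.
Unset Printing Implicit Defensive.

Import Order.TTheory GRing.Theory Num.Theory.
Local Open Scope ring_scope.
Local Open Scope complex_scope.

(** The complex numbers are [R[i]] for a [realType] [R]; [normc] is the
    [R]-valued modulus. A finite group is the whole of a [finGroupType]. *)
Notation normc := Normc.normc.

Definition disc_valued (R : realType) (gT : finGroupType) (f : gT -> R[i]) :
    Prop :=
  forall x, normc (f x) <= 1.

Definition mean (R : realType) (T : finType) (h : T -> R) : R :=
  (\sum_(x : T) h x) / #|T|%:R.

Definition l2norm (R : realType) (gT : finGroupType) (h : gT -> R[i]) : R :=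
  Num.sqrt (mean (fun x => normc (h x) ^+ 2)).

Definition dist (R : realType) (gT : finGroupType) (f g : gT -> R[i]) : R :=
  2^-1 * l2norm (fun x => f x - g x).

Definition property (R : realType) (gT : finGroupType) : Type :=
  (gT -> R[i]) -> Prop.

Definition far (R : realType) (gT : finGroupType) (eps : R)
    (P : property R gT) (f : gT -> R[i]) : Prop :=
  forall g : gT -> R[i], disc_valued g -> P g -> eps <= dist f g.

Definition hom_property (R : realType) (gT : finGroupType) : property R gT :=
  fun f => forall x y : gT, f x * f y = f (x * y)%g.

(** Adaptive randomized algorithms with oracle access to a function
    [gT -> R[i]]. Continuations are arbitrary functions, so group operations
    and all other computations between two steps are free; the oracle is only
    accessible through [Query], and the randomness only through independent
    uniform elements of the group ([Sample]) and fair coins ([Flip]). *)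
Inductive algorithm (R : realType) (gT : finGroupType) : Type :=
| Output of bool
| Sample of (gT -> algorithm R gT)
| Flip of (bool -> algorithm R gT)
| Query of gT & (R[i] -> algorithm R gT).

(** Probability that [A], run with oracle [f], outputs [b], where [true] means
    "accept" and [false] means "reject" *)
Fixpoint output_prob (R : realType) (gT : finGroupType) (f : gT -> R[i])
    (b : bool) (A : algorithm R gT) : R :=
  match A with
  | Output b' => (b' == b)%:R
  | Sample k => mean (fun x : gT => output_prob f b (k x))
  | Flip k => mean (fun c : bool => output_prob f b (k c))
  | Query x k => output_prob f b (k (f x))
  end.

(** Largest number of queries that [A] makes to the oracle [f], over all
    outcomes of its random choices *)
Fixpoint nqueries (R : realType) (gT : finGroupType) (f : gT -> R[i])
    (A : algorithm R gT) : nat :=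
  match A with
  | Output _ => 0%N
  | Sample k => (\max_(x : gT) nqueries f (k x))%N
  | Flip k => (\max_(c : bool) nqueries f (k c))%N
  | Query x k => (nqueries f (k (f x))).+1
  end.

Definition query_complexity_le (R : realType) (gT : finGroupType)
    (A : algorithm R gT) (q : R) : Prop :=
  forall f : gT -> R[i], disc_valued f -> (nqueries f A)%:R <= q.

(** [T eps] is the algorithm run on input [eps]. *)
Definition tester (R : realType) (gT : finGroupType) (P : property R gT)
    (T : R -> algorithm R gT) : Prop :=
  forall (eps : R) (f : gT -> R[i]), 0 < eps -> disc_valued f ->
    (P f -> 2 / 3 <= output_prob f true (T eps)) /\
    (far eps P f -> 2 / 3 <= output_prob f false (T eps)).

Definition one_sided_tester (R : realType) (gT : finGroupType)
    (P : property R gT) (T : R -> algorithm R gT) : Prop :=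
  tester P T /\
  forall (eps : R) (f : gT -> R[i]), 0 < eps -> disc_valued f ->
    P f -> output_prob f true (T eps) = 1.

(* Main.v *)
Require Import Defs.
From mathcomp Require Import all_boot all_order all_algebra all_fingroup.
From mathcomp Require Import all_classical all_reals all_analysis.
From mathcomp Require Import complex.
From mathcomp Require Import zify ring lra.

Import Order.TTheory GRing.Theory Num.Theory.
Local Open Scope ring_scope.

(** Repeat the exact test [f x * f y = f (x * y)] at random [x], [y]. Let [d] be
    its failure probability. Comparing [x] and [x * y], where [f x = 0] and
    [f (x * y) <> 0] is a failure, shows that if [z] is the density of zeros of
    [f] then [z (1 - z) <= d], so [f] is either mostly zero, hence close to the
    homomorphism [0], or almost nowhere zero. In the latter case the zeros are
    replaced by [1] and Blum-Luby-Rubinfeld self-correction applies to the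
    resulting map into the multiplicative group of the field. Either way [f]
    differs from a homomorphism at a fraction [O(d)] of the points; since values
    lie in the unit disc, the squared distance is at most that fraction, so
    [O(eps^-2)] repetitions suffice. *)

(** * Self-correction for maps into a field, by counting *)

Definition violations {gT : finGroupType} {F : fieldType} (f : gT -> F) : nat :=
  (\sum_x \sum_y (f x * f y != f (x * y)%g)%R)%N.

Lemma sum_mulg {gT : finGroupType} (x : gT) (h : gT -> nat) :
  (\sum_y h (x * y)%g = \sum_y h y)%N.
Proof. by rewrite [RHS](reindex_inj (mulgI x)). Qed.

Lemma sum_bool_pick {T : finType} (P : pred T) :
  (\sum_x P x < #|T|)%N -> exists x, ~~ P x.
Proof.
move=> lt; apply/existsP; apply: contraLR lt => /existsPn nP; rewrite -leqNgt.
by rewrite -sum1_card; apply: leq_sum => x _; rewrite (negPn (nP x)).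
Qed.

(** If [f z * f (z^-1 * y) = f y] and [f (x * z) * f (z^-1 * y) = f (x * y)], dividing cancels the
    common factor and the two quotients agree. As [z] and [y] vary, each equation runs over all
    product tests once, whence the factor 2. *)
Lemma quotient_disagreement {gT : finGroupType} {F : fieldType} (f : gT -> F)
    (x : gT) : (forall y, f y != 0) ->
  (\sum_z \sum_y (f (x * y)%g / f y != f (x * z)%g / f z)%R <= 2 * violations f)%N.
Proof.
move=> f0; rewrite mul2n -addnn.
have E1 : violations f = (\sum_z \sum_y (f z * f (z^-1 * y)%g != f y)%R)%N.
  apply: eq_bigr => z _.
  by rewrite -[RHS](sum_mulg z); apply: eq_bigr => y _; rewrite mulKg.
have E2 : violations f =
    (\sum_z \sum_y (f (x * z)%g * f (z^-1 * y)%g != f (x * y)%g)%R)%N.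
  rewrite /violations -(sum_mulg x); apply: eq_bigr => z _.
  by rewrite -[RHS](sum_mulg z); apply: eq_bigr => y _; rewrite mulKg mulgA.
rewrite {1}E1 E2 -big_split /=; apply: leq_sum => z _.
rewrite -big_split /=; apply: leq_sum => y _.
case: eqP => // ne; case: eqP => //= e1; case: eqP => //= e2; case: ne.
have := f0 (z^-1 * y)%g; have := f0 z; rewrite -e1 -e2 => n1 n2.
by field; rewrite n1 n2.
Qed.

(* Blum-Luby-Rubinfeld self-correction: [g x] is a popular value of
   [f (x * z) / f z]. *)
Lemma blr_nonzero {gT : finGroupType} {F : fieldType} (f : gT -> F) :
  (forall y, f y != 0) -> (6 * violations f < #|gT| * #|gT|)%N ->
  exists2 g : gT -> F, (forall x y, g x * g y = g (x * y)%g) &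
    ((\sum_x (f x != g x)%R) * #|gT| <= 3 * violations f)%N.
Proof.
move=> f0 small.
pose bad x v := (\sum_y (f (x * y)%g / f y != v)%R)%N.
(* Averaging over [z]: if every candidate value exceeded the bound, the sum of the disagreements
   would exceed [2 * violations f]. *)
have popular x : exists z, (bad x (f (x * z)%g / f z)%R * #|gT| <= 2 * violations f)%N.
  apply/existsP; apply: contraT => /existsPn big.
  have := quotient_disagreement f x f0.
  set S := (\sum_z _)%N => leS.
  have : (\sum_(z : gT) (2 * violations f).+1 <= S * #|gT|)%N.
    rewrite /S big_distrl /=; apply: leq_sum => z _.
    by have := big z; rewrite -ltnNge.
  have n0 : (0 < #|gT|)%N by apply/card_gt0P; exists 1%g.
  rewrite sum_nat_const (_ : #|_| = #|gT|) // => h.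
  by move: leS; rewrite -(leq_pmul2r n0) => /(leq_trans h); rewrite mulnC leq_pmul2r // ltnn.
pose g x := let z := xchoose (popular x) in f (x * z)%g / f z.
have gP x : (bad x (g x) * #|gT| <= 2 * violations f)%N := xchooseP (popular x).
exists g => [x y|].
  (* Fewer than [#|gT|] points [z] are bad for one of the three popular values, since
     [6 * violations f < #|gT| * #|gT|]. At any other [z] the quotients for [x] (taken at [y * z])
     and for [y] telescope to the one for [x * y]. *)
  have [|z] := sum_bool_pick (fun z =>
      [|| (f (x * (y * z))%g / f (y * z)%g != g x)%R, (f (y * z)%g / f z != g y)%R |
        (f (x * y * z)%g / f z != g (x * y)%g)%R]).
    have le : (\sum_z [|| (f (x * (y * z))%g / f (y * z)%g != g x)%R,
        (f (y * z)%g / f z != g y)%R | (f (x * y * z)%g / f z != g (x * y)%g)%R]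
        <= bad x (g x) + bad y (g y) + bad (x * y)%g (g (x * y)%g))%N.
      rewrite /bad -(sum_mulg y (fun z => (f (x * z)%g / f z != g x)%R : nat)).
      rewrite -!big_split /=; apply: leq_sum => z _.
      by do 3 case: (_ == _).
    have n0 : (0 < #|gT|)%N by apply/card_gt0P; exists 1%g.
    apply: leq_ltn_trans le _; rewrite -(ltn_pmul2r n0).
    apply: leq_ltn_trans small; rewrite !mulnDl.
    by have := gP x; have := gP y; have := gP (x * y)%g; lia.
  rewrite !negb_or !negbK => /and3P[/eqP e1 /eqP e2 /eqP e3].
  by rewrite -e1 -e2 -e3 mulgA mulrA divfK.
have sumbad : (\sum_x bad x (g x) <= 2 * violations f)%N.
  have n0 : (0 < #|gT|)%N by apply/card_gt0P; exists 1%g.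
  rewrite -(leq_pmul2r n0) big_distrl /= mulnC -sum_nat_const.
  by apply: leq_sum => x _; apply: gP.
(* If [f x] differs from [g x], then for every [y] either the test at [(x, y)] fails or [y] is bad
   for [g x]: total at most 1 + 2 times [violations f]. *)
rewrite big_distrl /= mulSn.
apply: leq_trans (leq_add (leqnn _) sumbad).
rewrite -big_split /=; apply: leq_sum => x _.
rewrite mulnC -sum_nat_const -big_split /=; apply: leq_sum => y _.
case: eqP => // ne; case: eqP => //= e1; case: eqP => //= e2; case: ne.
by rewrite -e2 -e1 mulfK.
Qed.

Lemma zero_count_violations {gT : finGroupType} {F : fieldType} (f : gT -> F) :
  ((\sum_x (f x == 0%R)) * (\sum_x (f x != 0%R)) <= violations f)%N.
Proof.
rewrite big_distrl /=; apply: leq_sum => x _.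
rewrite big_distrr /= -(sum_mulg x); apply: leq_sum => y _.
by case: (eqVneq (f x) 0) => //= ->; rewrite mul0r eq_sym mul1n.
Qed.

Lemma blr_field {gT : finGroupType} {F : fieldType} (f : gT -> F) :
  (30 * violations f < #|gT| * #|gT|)%N ->
  exists2 g : gT -> F, (forall x y, g x * g y = g (x * y)%g) &
    ((\sum_x (f x != g x)%R) * #|gT| <= 17 * violations f)%N.
Proof.
move=> small; have := zero_count_violations f.
set k := (\sum_x (f x == 0%R))%N; set l := (\sum_x (f x != 0%R))%N => kl.
have kln : (k + l = #|gT|)%N.
  rewrite -sum1_card -big_split /=; apply: eq_bigr => x _.
  by case: (f x == 0).
(* If zeros are at least half, take [g = 0]: it errs at [l] points and
   [l * (k + l) <= 2 * k * l]. *)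
case: (leqP l k) => [lk|kltl].
  exists (fun=> 0) => [x y|]; first by rewrite mul0r.
  by rewrite -/l -kln mulnDr; have := leq_mul lk (leqnn l); lia.
have kn : (k * #|gT| <= 2 * violations f)%N.
  by rewrite -kln mulnDr; have := leq_mul (leqnn k) (ltnW kltl); lia.
pose f' x := if f x == 0 then 1 else f x.
have f'0 y : f' y != 0 by rewrite /f'; case: (eqVneq (f y) 0) => // _; apply: oner_neq0.
have D' : (violations f' <= violations f + k * #|gT| + k * #|gT|)%N.
  have e1 : (k * #|gT| = \sum_(x : gT) \sum_(y : gT) (f x == 0%R))%N.
    rewrite big_distrl; apply: eq_bigr => x _ /=.
    by rewrite sum_nat_const mulnC.
  have e2 : (k * #|gT| = \sum_(x : gT) \sum_(y : gT) (f y == 0%R))%N.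
    by rewrite sum_nat_const mulnC.
  rewrite {1}e1 e2 -!big_split /=; apply: leq_sum => x _.
  rewrite -!big_split /=; apply: leq_sum => y _.
  rewrite /f'; case: (eqVneq (f x) 0) => [//|x0] /=.
    by move=> _; rewrite addnAC addn1; apply: leq_trans (leq_b1 _) _.
  case: (eqVneq (f y) 0) => [_|y0] /=.
    by rewrite !addn1; apply: leq_trans (leq_b1 _) _.
  (* A zero at [x * y] with [f x] and [f y] nonzero is already a violation of [f], so only zeros at
     [x] and [y] are charged. *)
  case: (eqVneq (f (x * y)%g) 0) => [->|_] /=; last by rewrite !addn0.
  by rewrite mulf_neq0 // !addn0 leq_b1.
(* [f'] has at most 1 + 2 + 2 = 5 times the violations of [f]; hence 30 = 6 * 5, and 17 = 3 * 5 + 2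
   once the zeros are added back. *)
have [|g gM gf] := blr_nonzero f' f'0; first by lia.
exists g => //.
have le : (\sum_x (f x != g x)%R <= \sum_x (f' x != g x)%R + k)%N.
  rewrite -big_split /=; apply: leq_sum => x _; rewrite /f'.
  case: (eqVneq (f x) 0) => _ /=; last by rewrite addn0.
  by rewrite addn1; apply: leq_trans (leq_b1 _) _.
apply: leq_trans (leq_mul le (leqnn _)) _; rewrite mulnDl.
apply: leq_trans (leq_add gf kn) _; lia.
Qed.

(** * Homomorphisms into the disc, and means *)

Lemma normc_ge0 {R : rcfType} (z : R[i]%C) : 0 <= normc z.
Proof. by case: z => a b; apply: sqrtr_ge0. Qed.

(** Self-correction gives a homomorphism with no bound on its values, whereas [far] only compares
    with disc-valued ones. Finite order supplies the bound: [normc (f x) ^+ #[x]] is [normc (f 1)],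
    and [f 1] is idempotent, so 0 or 1. *)
Lemma hom_disc_valued {R : realType} {gT : finGroupType} (f : gT -> R[i]%C) :
  hom_property f -> disc_valued f.
Proof.
move=> fM x.
(* Positive exponents only: at exponent 0 the equation fails for [f = 0]. *)
have fX n : normc (f (x ^+ n.+1)%g) = normc (f x) ^+ n.+1.
  elim: n => [|n IHn]; first by rewrite expg1 expr1.
  by rewrite expgS -fM Normc.normcM IHn -exprS.
have f1 : normc (f 1%g) <= 1.
  have /eqP := fM 1%g 1%g; rewrite mulg1 -subr_eq0 -{3}[f 1%g]mulr1 -mulrBr.
  rewrite mulf_eq0 subr_eq0 => /orP[]/eqP->; last by rewrite Normc.normc1.
  by rewrite Normc.normc0.
have := fX #[x]%g.-1; rewrite prednK ?order_gt0 // expg_order => e.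
by move: f1; rewrite e expr_le1 ?order_gt0 // normc_ge0.
Qed.

Section Mean.
Context {R : realType} {T : finType}.
Implicit Types h : T -> R.

Lemma eq_mean h1 h2 : h1 =1 h2 -> mean h1 = mean h2.
Proof. by move=> e; rewrite /mean (eq_bigr _ (fun x _ => e x)). Qed.

Lemma meanD h1 h2 : mean (fun x => h1 x + h2 x) = mean h1 + mean h2.
Proof. by rewrite /mean big_split mulrDl. Qed.

Lemma meanZ (c : R) h : mean (fun x => c * h x) = c * mean h.
Proof. by rewrite /mean -mulr_sumr mulrA. Qed.

Lemma le_mean h1 h2 : (forall x, h1 x <= h2 x) -> mean h1 <= mean h2.
Proof. by move=> le; rewrite ler_wpM2r ?invr_ge0 ?ler0n // ler_sum. Qed.

Lemma mean_cst (c : R) : (0 < #|T|)%N -> mean (fun _ : T => c) = c.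
Proof.
move=> T0; rewrite /mean sumr_const -[c *+ _]mulr_natr mulfK //.
by rewrite pnatr_eq0 -lt0n.
Qed.

End Mean.

Lemma card_finGroup_gt0 (gT : finGroupType) : (0 < #|gT|)%N.
Proof. by apply/card_gt0P; exists 1%g. Qed.

Lemma output_prob_total {R : realType} {gT : finGroupType} (f : gT -> R[i]%C)
    (A : algorithm R gT) : output_prob f true A + output_prob f false A = 1.
Proof.
elim: A => [b|k IH|k IH|x k IH] /=; last exact: IH.
- by case: b; rewrite ?addr0 ?add0r.
- by rewrite -meanD (eq_mean _ (fun=> 1)) ?mean_cst // card_finGroup_gt0.
by rewrite -meanD (eq_mean _ (fun=> 1)) ?mean_cst // card_bool.
Qed.

(** * The repeated test and its acceptance probability *)

Definition violation_density {R : realType} {gT : finGroupType}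
    (f : gT -> R[i]%C) : R :=
  mean (fun x => mean (fun y => (f x * f y != f (x * y)%g)%:R)).

Lemma violation_densityE {R : realType} {gT : finGroupType} (f : gT -> R[i]%C) :
  violation_density f = (violations f)%:R / (#|gT| * #|gT|)%:R.
Proof.
rewrite /violation_density /mean -mulr_suml natrM invfM mulrA.
rewrite /violations natr_sum; do 2 congr (_ * _).
by apply: eq_bigr => x _; rewrite natr_sum.
Qed.

Lemma violation_density_ge0 {R : realType} {gT : finGroupType} (f : gT -> R[i]%C) :
  0 <= violation_density f.
Proof. by rewrite violation_densityE divr_ge0. Qed.

Lemma violation_density_le1 {R : realType} {gT : finGroupType} (f : gT -> R[i]%C) :
  violation_density f <= 1.
Proof.
rewrite -[leRHS](mean_cst 1 (card_finGroup_gt0 gT)); apply: le_mean => x.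
rewrite -[leRHS](mean_cst 1 (card_finGroup_gt0 gT)); apply: le_mean => y.
by rewrite lern1 leq_b1.
Qed.

Lemma hom_violation_density {R : realType} {gT : finGroupType} (f : gT -> R[i]%C) :
  hom_property f -> violation_density f = 0.
Proof.
move=> fM; rewrite violation_densityE [violations f]big1 ?mul0r // => x _.
by rewrite big1 // => y _; rewrite fM eqxx.
Qed.

Fixpoint hom_test (R : realType) (gT : finGroupType) (m : nat) : algorithm R gT :=
  if m is m'.+1 then
    Sample (fun x => Sample (fun y =>
      Query x (fun a => Query y (fun b => Query (x * y)%g (fun c =>
        if a * b == c then hom_test R gT m' else Output R gT false)))))
  else Output R gT true.

Lemma output_prob_hom_test {R : realType} {gT : finGroupType} (f : gT -> R[i]%C)
    (m : nat) :
  output_prob f true (hom_test R gT m) = (1 - violation_density f) ^+ m.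
Proof.
elim: m => [|m IHm] //=; rewrite exprSr -IHm.
set p := output_prob _ _ _; pose c x y : R := (f x * f y != f (x * y)%g)%:R.
rewrite (eq_mean _ (fun x => p * (1 + -1 * mean (c x)))) => [|x].
  by rewrite meanZ meanD meanZ mean_cst ?card_finGroup_gt0 // mulN1r.
rewrite (eq_mean _ (fun y => p * (1 + -1 * c x y))) => [|y].
  by rewrite meanZ meanD meanZ mean_cst ?card_finGroup_gt0.
by rewrite /c; case: eqP => _ /=; rewrite ?mulr0 ?addr0 ?mulr1 // subrr mulr0.
Qed.

Lemma nqueries_hom_test {R : realType} {gT : finGroupType} (f : gT -> R[i]%C)
    (m : nat) : (nqueries f (hom_test R gT m) <= 3 * m)%N.
Proof.
elim: m => [|m IHm] //=; apply/bigmax_leqP => x _; apply/bigmax_leqP => y _.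
by rewrite mulnS; case: ifP => _ /=; rewrite !ltnS.
Qed.

(** Division-free form of [(1 - d)^m <= 1 / (1 + m d)]; once [m d >= 2] the acceptance probability
    is at most 1/3. *)
Lemma bernoulli_inv {R : realDomainType} (d : R) (m : nat) : 0 <= d -> d <= 1 ->
  (1 - d) ^+ m * (1 + m%:R * d) <= 1.
Proof.
move=> d0 d1; elim: m => [|m IHm]; first by rewrite mul0r addr0 mulr1.
apply: le_trans IHm; rewrite exprSr -mulrA ler_wpM2l //.
  by rewrite exprn_ge0 // subr_ge0.
have := ler0n R m; rewrite -natr1; nra.
Qed.

(** * Distance, far functions and the tester *)

Lemma dist_ge0 {R : realType} {gT : finGroupType} (f g : gT -> R[i]%C) :
  0 <= dist f g.
Proof. by rewrite mulr_ge0 ?invr_ge0 ?ler0n // sqrtr_ge0. Qed.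

Lemma sqr_dist {R : realType} {gT : finGroupType} (f g : gT -> R[i]%C) :
  dist f g ^+ 2 = mean (fun x => 4^-1 * normc (f x - g x) ^+ 2).
Proof.
rewrite exprMn sqr_sqrtr; last first.
  rewrite -[leLHS](mean_cst 0 (card_finGroup_gt0 gT)).
  by apply: le_mean => x; rewrite sqr_ge0.
by rewrite meanZ; congr (_ * _); field.
Qed.

Lemma dist0_le {R : realType} {gT : finGroupType} (f : gT -> R[i]%C) :
  disc_valued f -> dist f (fun=> 0) <= 2^-1.
Proof.
move=> fD; rewrite -(@ler_pXn2r _ 2) ?nnegrE ?dist_ge0 ?invr_ge0 //.
rewrite sqr_dist -[leRHS](mean_cst (2^-1 ^+ 2) (card_finGroup_gt0 gT)).
apply: le_mean => x; rewrite subr0.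
by have := fD x; have := normc_ge0 (f x); nra.
Qed.

Lemma sqr_dist_le {R : realType} {gT : finGroupType} (f g : gT -> R[i]%C) :
  disc_valued f -> disc_valued g ->
  dist f g ^+ 2 <= (\sum_x (f x != g x)%R)%N%:R / #|gT|%:R.
Proof.
move=> fD gD; rewrite sqr_dist natr_sum; apply: le_mean => x.
case: eqVneq => [->|_] /=; first by rewrite subrr Normc.normc0 expr0n mulr0.
(* Points of the disc are at distance at most 2, and the factor 1/4 from [dist] absorbs the
   square. *)
have := le_normcD (f x) (- g x); rewrite normcN.
have := fD x; have := gD x; have := normc_ge0 (f x - g x); nra.
Qed.

Lemma far_hom_le_half {R : realType} {gT : finGroupType} (eps : R)
    (f : gT -> R[i]%C) : disc_valued f -> far eps (@hom_property R gT) f -> eps <= 2^-1.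
Proof.
move=> fD ffar; apply: le_trans (dist0_le f fD); apply: ffar => [x|x y].
  by rewrite Normc.normc0.
by rewrite mulr0.
Qed.

Lemma far_hom_violation_density {R : realType} {gT : finGroupType} (eps : R)
    (f : gT -> R[i]%C) : 0 < eps -> disc_valued f ->
  far eps (@hom_property R gT) f -> eps ^+ 2 <= 30 * violation_density f.
Proof.
move=> eps0 fD ffar; rewrite violation_densityE.
have n0 : 0 < #|gT|%:R :> R by rewrite ltr0n card_finGroup_gt0.
have nn0 : 0 < (#|gT| * #|gT|)%:R :> R by rewrite natrM mulr_gt0.
rewrite mulrA ler_pdivlMr //.
have [small|big] := ltnP (30 * violations f) (#|gT| * #|gT|).
  have [g gM fg] := blr_field f small; have gD := hom_disc_valued g gM.
  have le : eps ^+ 2 <= dist f g ^+ 2.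
    by rewrite ler_pXn2r ?nnegrE ?dist_ge0 ?(ltW eps0) //; apply: ffar.
  have := le_trans le (sqr_dist_le f g fD gD).
  rewrite ler_pdivlMr // -(ler_pM2r n0) -mulrA -natrM => /le_trans; apply.
  rewrite -!natrM ler_nat; apply: leq_trans fg _.
  by rewrite leq_mul2r orbT.
(* With too many violations for self-correction, [30 * violations f] is at least [#|gT| * #|gT|],
   and [eps <= 1/2] suffices. *)
have eps2 := far_hom_le_half eps f fD ffar.
rewrite -[30 * _]natrM; apply: le_trans (_ : (#|gT| * #|gT|)%:R <= _); last first.
  by rewrite ler_nat.
by rewrite ler_piMl ?(ltW nn0) //; nra.
Qed.

(** The zero homomorphism is within 1/2 of every disc-valued function, so for larger [eps] nothing
    needs rejecting. Otherwise [d >= eps^2 / 30] for far functions, and more than [60 / eps^2]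
    rounds make [m d >= 2]. *)
Definition hom_tester (R : realType) (gT : finGroupType) (eps : R) :
    algorithm R gT :=
  if eps <= 2^-1 then hom_test R gT (Num.truncn (60 / eps ^+ 2)).+1
  else Output R gT true.

Lemma hom_tester_one_sided (R : realType) (gT : finGroupType) :
  one_sided_tester (@hom_property R gT) (hom_tester R gT).
Proof.
have accept eps f : hom_property f -> output_prob f true (hom_tester R gT eps) = 1.
  move=> fM; rewrite /hom_tester; case: ifP => // _.
  by rewrite output_prob_hom_test hom_violation_density // subr0 expr1n.
split=> [eps f eps0 fD|eps f _ _]; last exact: accept.
split=> [fM|ffar]; first by rewrite accept //; lra.
rewrite /hom_tester (far_hom_le_half eps f fD ffar).
set m := (Num.truncn _).+1; set A := hom_test _ _ _.
have := output_prob_total f A; rewrite output_prob_hom_test.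
set q := output_prob _ _ _; set d := violation_density f.
have := bernoulli_inv d m (violation_density_ge0 f) (violation_density_le1 f).
have md : 2 <= m%:R * d.
  have e20 : 0 < eps ^+ 2 by rewrite exprn_gt0.
  have : 60 < m%:R * eps ^+ 2.
    rewrite -ltr_pdivrMr //.
    by have /andP[] := truncn_itv (divr_ge0 (ler0n R 60) (ltW e20)).
  have := far_hom_violation_density eps f eps0 fD ffar; rewrite -/d.
  have : 0 <= m%:R :> R by []; nra.
have : 0 <= (1 - d) ^+ m by rewrite exprn_ge0 // subr_ge0 violation_density_le1.
nra.
Qed.

(* For [eps] close to 1 the bound forbids any query; this is harmless because
   no function is [eps]-far when [eps > 1/2]. *)
Lemma hom_tester_queries (R : realType) (gT : finGroupType) (eps : R) :
  0 < eps -> eps < 1 ->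
  query_complexity_le (hom_tester R gT eps) (366 * (eps ^- 2 * ln (1 / eps))).
Proof.
move=> eps0 eps1 f fD.
have e20 : 0 < eps ^+ 2 by rewrite exprn_gt0.
have ln_ge : 1 - eps <= ln (1 / eps).
  rewrite div1r lnV ?posrE // lerNr opprB.
  by have := @le_ln1Dx R (eps - 1); rewrite (addrC 1) subrK; apply; lra.
rewrite /hom_tester; case: ifP => [le2|_]; last first.
  by rewrite !mulr_ge0 ?invr_ge0 ?(ltW e20) //; lra.
set m := Num.truncn _.
apply: le_trans (_ : (3 * m.+1)%:R <= _); first by rewrite ler_nat nqueries_hom_test.
have i1 : 1 <= eps ^- 2 by rewrite invf_ge1 //; nra.
have mle : m%:R <= 60 * eps ^- 2.
  by have /andP[] := truncn_itv (divr_ge0 (ler0n R 60) (ltW e20)).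
have : eps ^- 2 * 2^-1 <= eps ^- 2 * ln (1 / eps).
  by rewrite ler_wpM2l ?invr_ge0 ?(ltW e20) //; lra.
(* Here [3 * (m + 1) <= 183 * eps ^- 2], and [ln (1 / eps) >= 1/2] doubles the constant to 366. *)
rewrite natrM -(natr1 m); lra.
Qed.

Theorem theorem4p1 (R : realType) :
  exists C : R, 0 < C /\
    forall gT : finGroupType,
      exists T : R -> algorithm R gT,
        one_sided_tester (@hom_property R gT) T /\
        forall eps : R, 0 < eps -> eps < 1 ->
          query_complexity_le (T eps) (C * (eps ^- 2 * ln (1 / eps))).
Proof.
exists 366; split=> [|gT]; first by [].
exists (hom_tester R gT); split; first exact: hom_tester_one_sided.
exact: hom_tester_queries.
Qed.
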